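(* Let $G$ be a graph on a totally ordered vertex set $V$ with $|V|=n$. (1) The coefficient of $(-1)^{n-1}x$ in the chromatic polynomial $\chi_G(x)$ is the number of increasing $G$-connected trees (on $V$). (2) For each $q$, the coefficient of $(-1)^{n-q}x^q$ in the chromatic polynomial $\chi_G(x)$ is the number of increasing $G$-connected forests (on $V$) with $q$ components (or, equivalently, with $n-q$ edges). (3) For each integer partition $\lambda$ of $n$, the coefficient of $(-1)^{n-\ell(\lambda)}p_\lambda$ in the chromatic symmetric function $X_G$ is the number of increasing $G$-connected forests $R$ on $V$ such that $t(R)=\lambda$. (4) For each set partition $\pi$ of $V$, the coefficient of $(-1)^{n-\ell(\pi)}p_\pi$ in the chromatic symmetric function in non-commuting variables $Y_G$ is the number of increasing $G$-connected forests $R$ on $V$ such that $s(R)=\pi$.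
   Context: All graphs are finite labeled simple graphs; a graph on $V$ is identified with its edge set. $G|_S$ is the restriction (induced subgraph) of $G$ to $S\subseteq V$. For a graph $G$ on $V$, $s(G)$ is the set partition of $V$ in which two vertices are in the same block if and only if they are joined by a path in $G$; the restriction of $G$ to a block of $s(G)$ is a component of $G$; $t(G)$ is the integer partition whose parts are the sizes of the blocks of $s(G)$. $\ell(\pi)$ (resp. $\ell(\lambda)$) is the number of blocks of a set partition $\pi$ (resp. parts of an integer partition $\lambda$). For a rooted tree $R$: $w$ is a descendant of $v$ if $v$ lies on the unique path from the root to $w$ (so $v$ is a descendant of itself); $\mathrm{des}(v,R)$ is the set of descendants of $v$; for $v$ not the root, $\mathrm{parent}(v,R)$ is the closest vertex to $v$ that is not a descendant of $v$. A rooted tree on a totally ordered vertex set is increasing if $v\le w$ for all vertices $v$ and all $w\in\mathrm{des}(v,R)$; its root is then the smallest vertex. For $v$ not the root, $J(v,R)$ is the set of all possible edges joining $\mathrm{parent}(v,R)$ to an element of $\mathrm{des}(v,R)$. For a graph $G$ on the vertex set of $R$, $R$ is $G$-connected if $J(v,R)\cap G\ne\emptyset$ for every non-root vertex $v$. ($R$ need not be a subgraph of $G$.) An increasing $G$-connected forest on $V$ is a forest $R$ on $V$ (a graph without circuits) such that for each block $B$ of $s(R)$ the component $R|_B$ (rooted at the smallest element of $B$) is an increasing $G|_B$-connected tree. $\chi_G(x)$ is the polynomial evaluating to the number of proper colorings of $G$ with $x$ colors. $X_G=\sum_\kappa\prod_{v\in V}x_{\kappa(v)}$, summed over all proper colorings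 $\kappa:V\to\{1,2,\ldots\}$ of $G$, in commuting variables $x_1,x_2,\ldots$; $p_\lambda=\prod_i p_{\lambda_i}$ with $p_m=\sum_j x_j^m$ are the power sum symmetric functions, and coefficients are taken in the expansion in the basis $\{p_\lambda\}$. In non-commuting variables $x_1,x_2,\ldots$, writing $V=\{v_1<\cdots<v_n\}$, $Y_G=\sum_\kappa x_{\kappa(v_1)}x_{\kappa(v_2)}\cdots x_{\kappa(v_n)}$, summed over all proper colorings $\kappa:V\to\{1,2,\ldots\}$ of $G$; for a set partition $\pi$ of $V$, $p_\pi=\sum_{(i_1,\ldots,i_n)}x_{i_1}x_{i_2}\cdots x_{i_n}$, summed over all sequences of positive integers with $i_j=i_k$ whenever $v_j$ and $v_k$ are in the same block of $\pi$; coefficients are taken in the expansion in the linearly independent family $\{p_\pi\}$. ''The coefficient of $(-1)^m z$'' in an expression means $(-1)^m$ times the coefficient of $z$. *)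

(* Defs.v *)
From mathcomp Require Import all_boot all_order all_algebra finmap.
From mathcomp Require Import monalg.

Set Implicit Arguments.
Unset Strict Implicit.
Unset Printing Implicit Defensive.

Import Order.TTheory GRing.Theory Num.Theory.
Local Open Scope ring_scope.

(* A graph on a finite type V (or on a subset B of V) is identified with its  *)
(* edge set, a set of two-element subsets of V.                               *)

Definition is_graph (V : finType) (G : {set {set V}}) : bool :=
  [forall e in G, #|e| == 2%N].

Definition adj (V : finType) (G : {set {set V}}) : rel V :=
  fun x y => [set x; y] \in G.

Definition restr (V : finType) (G : {set {set V}}) (B : {set V}) :
    {set {set V}} :=
  [set e in G | e \subset B].

Definition comp_partition (V : finType) (G : {set {set V}}) : {set {set V}} :=
  equivalence_partition (connect (adj G)) [set: V].

Definition comp_type (V : finType) (G : {set {set V}}) : seq nat :=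
  sort geq [seq #|(B : {set V})| | B <- enum (comp_partition G)].

(* ucycle lists the distinct vertices of a closed walk, so that a list of     *)
(* length 2 is an edge run back and forth, which is not a circuit; distinct   *)
(* vertices also make #|V| a sufficient bound on the length of the list.      *)
Definition acyclic (V : finType) (G : {set {set V}}) : bool :=
  [forall c : {bseq #|V| of V}, ucycleb (adj G) c ==> (size c <= 2)%N].

Definition rooted_tree (V : finType) (B : {set V}) (r : V)
    (T : {set {set V}}) : bool :=
  [&& is_graph T, [forall e in T, e \subset B], r \in B, acyclic T
    & [forall x in B, forall y in B, connect (adj T) x y]].

Definition des (V : finType) (r : V) (T : {set {set V}}) (v : V) : {set V} :=
  [set w | [exists p : {bseq #|V| of V},
     [&& path (adj T) r p, uniq (r :: p), last r p == w & v \in r :: p]]].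

(* p is a shortest walk from v to the complement of des r T v, and u is its   *)
(* endpoint; shortest walks have length less than #|V|.                       *)
Definition is_parent (V : finType) (r : V) (T : {set {set V}}) (v u : V) :
    bool :=
  (u \notin des r T v) &&
  [exists p : {bseq #|V| of V},
     [&& path (adj T) v p, last v p == u
       & [forall p' : {bseq #|V| of V},
            path (adj T) v p' && (last v p' \notin des r T v)
              ==> (size p <= size p')%N]]].

Definition parent_edges (V : finType) (r : V) (T : {set {set V}}) (v : V) :
    {set {set V}} :=
  [set [set u; w] | u in is_parent r T v, w in des r T v].

Definition connected_wrt (V : finType) (G : {set {set V}}) (B : {set V})
    (r : V) (T : {set {set V}}) : bool :=
  [forall v in B, (v != r) ==> (parent_edges r T v :&: G != set0)].

Definition increasing (d : Order.disp_t) (V : finOrderType d) (B : {set V})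
    (r : V) (T : {set {set V}}) : bool :=
  [forall v in B, forall w in des r T v, (v <= w)%O].

Definition inc_conn_tree (d : Order.disp_t) (V : finOrderType d)
    (G : {set {set V}}) (B : {set V}) (r : V) (T : {set {set V}}) : bool :=
  [&& rooted_tree B r T, increasing B r T & connected_wrt G B r T].

Definition inc_conn_forest (d : Order.disp_t) (V : finOrderType d)
    (G : {set {set V}}) (R : {set {set V}}) : bool :=
  [&& is_graph R, acyclic R
    & [forall B in comp_partition R, exists r in B,
         [forall w in B, (r <= w)%O]
           && inc_conn_tree (restr G B) B r (restr R B)]].

Definition proper_coloring (V : finType) (C : eqType) (G : {set {set V}})
    (kappa : V -> C) : bool :=
  [forall x, forall y, adj G x y ==> (kappa x != kappa y)].

Definition chromatic_polynomial (V : finType) (G : {set {set V}})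
    (chi : {poly rat}) : Prop :=
  forall k : nat,
    chi.[k%:R] = #|[set kappa : {ffun V -> 'I_k} | proper_coloring G kappa]|%:R.

(* A formal power series of bounded degree in x_1, x_2, ... is encoded by the *)
(* family, indexed by N, of the polynomials in N variables which it gives on  *)
(* setting x_j = 0 for all j > N; the series and the family determine each    *)
(* other.  The variables x_1, ..., x_N are indexed by 'I_N.  The polynomials  *)
(* are elements of the algebra of the free commutative monoid {cmonom 'I_N},  *)
(* or of the free monoid {fmonom 'I_N} when the variables do not commute.     *)

Definition comm_series := forall N : nat, {malg rat[{cmonom 'I_N}]}.
Definition noncomm_series := forall N : nat, {malg rat[{fmonom 'I_N}]}.

Definition chrom_sym (V : finType) (G : {set {set V}}) : comm_series := fun N =>
  \sum_(kappa : {ffun V -> 'I_N} | proper_coloring G kappa)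
    \prod_(v : V) << ucm (kappa v) >>.

Definition intpart : Type :=
  {lam : seq nat | sorted geq lam && all (fun m => 0 < m)%N lam}.

Definition psum (m : nat) : comm_series := fun N =>
  \sum_(j < N) << ucm j >> ^+ m.

Definition psum_part (lam : intpart) : comm_series := fun N =>
  \prod_(m <- val lam) psum m N.

Definition psum_expansion (F : comm_series)
    (c : {fsfun intpart -> rat with 0}) :
    Prop :=
  forall N : nat, F N = \sum_(lam <- finsupp c) c lam *: psum_part lam N.

Definition word (d : Order.disp_t) (V : finOrderType d) (N : nat)
    (i : V -> 'I_N) : {malg rat[{fmonom 'I_N}]} :=
  \prod_(v <- sort <=%O (enum V)) << fmu (i v) >>.

Definition chrom_nsym (d : Order.disp_t) (V : finOrderType d)
    (G : {set {set V}}) :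
    noncomm_series := fun N =>
  \sum_(kappa : {ffun V -> 'I_N} | proper_coloring G kappa) word kappa.

Definition setpart (V : finType) : Type :=
  {P : {set {set V}} | partition P [set: V]}.

Definition psum_setpart (d : Order.disp_t) (V : finOrderType d)
    (P : setpart V) : noncomm_series := fun N =>
  \sum_(i : {ffun V -> 'I_N} |
        [forall B in val P, forall x in B, forall y in B, i x == i y]) word i.

Definition psum_setpart_expansion (d : Order.disp_t) (V : finOrderType d)
    (F : noncomm_series) (c : {ffun setpart V -> rat}) : Prop :=
  forall N : nat, F N = \sum_(P : setpart V) c P *: psum_setpart P N.

(* Main.v *)
Require Import Defs.
From mathcomp Require Import all_boot all_order all_algebra finmap.
From mathcomp Require Import monalg.

Set Implicit Arguments.
Unset Strict Implicit.
Unset Printing Implicit Defensive.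

Import Order.TTheory GRing.Theory Num.Theory.
Local Open Scope ring_scope.

(** All the parts follow from one identity, [proper_coloring_forests]: for every
    map [kappa] from the vertices to colors,
      [kappa is a proper coloring of G] = sum over R of (-1) ^ #|R|,
    where [R] runs over the increasing [G]-connected forests all of whose
    components are monochromatic under [kappa].  Summing over [kappa] the
    noncommutative monomial of [kappa], its commutative monomial, or the
    constant 1 turns the indicator of the monochromatic colorings for [R] into
    [p_pi] with [pi = s(R)], into [p_lambda] with [lambda = t(R)], or into
    [k ^ q] with [q] the number of components.  As [#|R| = n - q]
    ([forest_card]), all forests contributing to a given basis element carry the
    same sign, so that the coefficient is that sign times their number.

    Orient the edges of a graph [R] from the smaller to the larger endpoint
    ([up R]).  The forest [R] is increasing exactly when each vertex ends at most
    one edge, its origin being then the parent, and descendants are the vertices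
    reached along the orientation.  With this description
    ([inc_conn_forestP]), being [G]-connected says that every edge [u -> v] has a
    [w] reachable from [v] with [{u, w}] in [G].

    To prove the identity, let [H] be the graph of the edges of [G] that are
    monochromatic under [kappa].  The increasing [G]-connected forests with
    monochromatic components are exactly the increasing [H]-connected forests
    ([inc_conn_forest_mono]), so the identity says that the signed number of
    increasing [H]-connected forests is 1 if [H] has no edge and 0 otherwise
    ([forest_sign_sum]).  If [H] has an edge, let [r] be the smallest vertex with
    a neighbor in [H], and let [w] be such a neighbor.  Vertices below [r] are
    isolated in every increasing [H]-connected forest [R], hence [r] is a root,
    and deleting [r] from [R] cuts off some subtrees.  The subtree containing [w]
    may be hung from [r] or not, because the edge [{r, w}] of [H] certifies the
    link.  Adding or removing the edge from [r] to the root of that subtree is an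
    involution that changes the sign ([toggle]).

    Uniqueness of the coefficients is uniqueness of an interpolating polynomial
    for [chi_G], and a triangularity argument ([triangular_system]) for the two
    families of power sums. *)

(** * Graphs, circuits and components *)

Section Graphs.
Variable V : finType.
Implicit Types (G R T : {set {set V}}) (B : {set V}).

Lemma adj_sym G : symmetric (adj G).
Proof. by move=> x y; rewrite /adj setUC. Qed.

Lemma adj_neq G x y : is_graph G -> adj G x y -> x != y.
Proof.
move=> /forall_inP gG /gG; apply: contraTneq => ->.
by rewrite setUid cards1.
Qed.

Lemma graphS G R : R \subset G -> is_graph G -> is_graph R.
Proof.
move=> /subsetP sRG /forall_inP gG; apply/forall_inP => e /sRG; exact: gG.
Qed.

Lemma adj_restr G B x y : adj (restr G B) x y = [&& adj G x y, x \in B & y \in B].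
Proof. by rewrite /adj inE subUset !sub1set. Qed.

Lemma restrT G : restr G [set: V] = G.
Proof. by apply/setP => e; rewrite inE subsetT andbT. Qed.

Lemma size_uniq_le (s : seq V) : uniq s -> (size s <= #|V|)%N.
Proof. by move=> /card_uniqP <-; apply: max_card. Qed.

Lemma acyclicP G :
  reflect (forall c, ucycle (adj G) c -> (size c <= 2)%N) (acyclic G).
Proof.
apply: (iffP forallP) => [aG c /andP[cG uG]|aG c].
  by have /implyP := aG (Bseq (size_uniq_le uG)); apply; apply/andP.
by apply/implyP => /aG.
Qed.

Lemma connect_adj_sym G : connect_sym (adj G).
Proof. exact/sym_connect_sym/adj_sym. Qed.

Lemma connect_adj_equiv G :
  {in [set: V] & &, equivalence_rel (connect (adj G))}.
Proof.
move=> x y z _ _ _; split; first exact: connect0.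
by move=> /(same_connect (connect_adj_sym G)) ->.
Qed.

Lemma comp_partitionP G : partition (comp_partition G) [set: V].
Proof. exact/equivalence_partitionP/connect_adj_equiv. Qed.

Lemma mem_comp_partition G B x y :
  B \in comp_partition G -> x \in B -> (y \in B) = connect (adj G) x y.
Proof.
move=> /imsetP[z _ ->]; rewrite !inE => zx.
by rewrite (same_connect (connect_adj_sym G) zx).
Qed.

Definition block_of G x : {set V} := [set y | connect (adj G) x y].

Lemma block_of_in G x : block_of G x \in comp_partition G.
Proof. by apply/imsetP; exists x => //; apply/setP => y; rewrite !inE. Qed.

Lemma mem_block_of G x : x \in block_of G x.
Proof. by rewrite inE connect0. Qed.

(** A block [B] is closed under adjacency, so reachability inside the component on
    [B] agrees with reachability in the whole graph; the lemma is used for both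
    [adj] and [up]. *)
Lemma connect_closed_restr (e e' : rel V) B x y :
    (forall u v, u \in B -> e u v -> v \in B) ->
    (forall u v, e' u v = [&& e u v, u \in B & v \in B]) ->
  x \in B -> connect e' x y = connect e x y.
Proof.
move=> clB e'E xB; apply/idP/idP.
  by apply: connect_sub => u v; rewrite e'E => /andP[/connect1].
case/connectP => p pP ->; elim: p x xB pP => [|z p IHp] x xB /=.
  by rewrite connect0.
case/andP => xz /IHp; have zB := clB _ _ xB xz.
move=> /(_ zB); apply: connect_trans; apply: connect1.
by rewrite e'E xz xB zB.
Qed.

End Graphs.

(** * Edges oriented upwards, descendants and parents *)

Section IncreasingForests.
Variables (d : Order.disp_t) (V : finOrderType d).
Implicit Types (G R T : {set {set V}}) (B : {set V}).

Definition up R : rel V := fun x y => adj R x y && (x < y)%O.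

Definition unique_parent R := forall u u' v, up R u v -> up R u' v -> u = u'.

Definition linked G R :=
  forall u v, up R u v -> exists2 w, connect (up R) v w & adj G u w.

Definition parentless R r := forall u, ~~ up R u r.

Lemma up_adj R x y : up R x y -> adj R x y.
Proof. by case/andP. Qed.

Lemma up_lt R x y : up R x y -> (x < y)%O.
Proof. by case/andP. Qed.

Lemma adj_up R x y : is_graph R -> adj R x y -> up R x y || up R y x.
Proof.
move=> gR xy; rewrite /up (adj_sym R y) xy /=.
by rewrite -neq_lt (adj_neq gR xy).
Qed.

Lemma up_edgeP R e : is_graph R -> e \in R -> exists u v, up R u v /\ e = [set u; v].
Proof.
move=> gR eR; have /forall_inP/(_ _ eR)/cards2P[x [y [xy eE]]] := gR.
have: adj R x y by rewrite /adj -eE.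
by case/(adj_up gR)/orP => h; [exists x, y | exists y, x; rewrite setUC].
Qed.

Lemma connect_upW R x y : connect (up R) x y -> connect (adj R) x y.
Proof. by apply: connect_sub => u v /up_adj/connect1. Qed.

Lemma connect_up_le R x y : connect (up R) x y -> (x <= y)%O.
Proof.
case/connectP => p pP ->; elim: p x pP => //= z p IHp x /andP[/up_lt/ltW xz].
by move=> /IHp; apply: le_trans.
Qed.

Lemma path_up_uniq R x p : path (up R) x p -> uniq (x :: p).
Proof.
move=> pP; apply: (@lt_sorted_uniq _ _ (x :: p)).
by apply: sub_path pP => u v /up_lt.
Qed.

(** Walking away from a vertex without parent, a downward step can only go to the
    unique parent, which the walk has already been able to reach upwards. *)
Lemma connect_up_root R r x : is_graph R -> unique_parent R -> parentless R r ->
  connect (adj R) r x -> connect (up R) r x.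
Proof.
move=> gR uR rR /connectP[p pP ->]; elim/last_ind: p pP => [|p z IHp].
  by rewrite connect0.
rewrite rcons_path last_rcons => /andP[/IHp ry].
case/(adj_up gR)/orP => [/connect1|zy]; first exact: connect_trans.
case/connectP: ry zy => q qP ->.
case/lastP: q qP => [_ /= zr|q t]; first by have := rR z; rewrite zr.
rewrite rcons_path last_rcons => /andP[qP ut] zt.
by rewrite (uR _ _ _ zt ut); apply/connectP; exists q.
Qed.

(** The first downward step of a path that has been going up would return to the
    vertex just left, since that one is the unique parent. *)
Lemma simple_path_up R x p : is_graph R -> unique_parent R ->
    path (adj R) x p -> uniq (x :: p) -> (forall u, up R u x -> u \notin p) ->
  path (up R) x p.
Proof.
move=> gR uR; elim: p x => //= y p IHp x /andP[xy pP].
case/andP => xp up_ hx.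
have uxy: up R x y.
  by case/(adj_up gR)/orP: (xy) => // /hx; rewrite inE eqxx.
rewrite uxy IHp // => u /(uR _ _ _ uxy) <-.
by move: xp; rewrite inE; case/norP.
Qed.

(** The simple paths from the root, which define descendants, are the increasing
    ones. *)
Lemma desE T r v : is_graph T -> unique_parent T -> parentless T r ->
  connect (adj T) r v -> des r T v = [set w | connect (up T) v w].
Proof.
move=> gT uT rT /(connect_up_root gT uT rT) /connectP[p pP vE].
apply/setP => w; rewrite !inE; apply/existsP/idP.
  case=> -[q _] /= /and4P[qP qu /eqP wE vq].
  have {}qP : path (up T) r q.
    by apply: (simple_path_up gT uT qP qu) => u; rewrite (negbTE (rT u)).
  case/splitPl: vq qP wE => q1 q2 q1E; rewrite cat_path last_cat q1E.
  by case/andP => _ q2P <-; apply/connectP; exists q2.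
case/connectP => q qP wE.
have pqP: path (up T) r (p ++ q) by rewrite cat_path pP -vE.
have pqu := path_up_uniq pqP.
have spq : (size (p ++ q) <= #|V|)%N by apply: size_uniq_le; case/andP: pqu.
exists (Bseq spq) => /=; apply/and4P; split=> //.
- by apply: sub_path pqP => a b /up_adj.
- by rewrite last_cat -vE wE.
- by rewrite -cat_cons mem_cat vE mem_last.
Qed.

Lemma exists_parent T r v : is_graph T -> unique_parent T -> parentless T r ->
  connect (adj T) r v -> v != r -> exists u, up T u v.
Proof.
move=> gT uT rT rv vr; case/connectP: (connect_up_root gT uT rT rv) => q qP vE.
case/lastP: q qP vE => [_ /= vE|q t]; first by rewrite vE eqxx in vr.
by rewrite rcons_path last_rcons => /andP[_ h] ->; exists (last r q).
Qed.

(** The parent is adjacent to [v] and is not a descendant of it, so shortest walks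
    leaving the descendants of [v] have one step, and that step goes down. *)
Lemma is_parentE T r v u : is_graph T -> unique_parent T -> parentless T r ->
  connect (adj T) r v -> v != r -> is_parent r T v u = up T u v.
Proof.
move=> gT uT rT rv vr; rewrite /is_parent (desE gT uT rT rv) inE.
have V1 : (0 < #|V|)%N by apply/card_gt0P; exists v.
have parent_out x : up T x v -> ~~ connect (up T) v x.
  by move=> /up_lt; apply: contraTN => /connect_up_le; rewrite leNgt.
apply/idP/idP; last first.
  move=> uv; rewrite parent_out //=; apply/existsP.
  exists (@Bseq #|V| _ [:: u] V1) => /=.
  rewrite (adj_sym T v) (up_adj uv) eqxx /=.
  apply/forallP => -[[|x q] qV] /=; last by rewrite implybT.
  by rewrite inE connect0.
case/andP => u_out /existsP; case=> -[p pV] /= /and3P[pP /eqP pu /forallP pmin].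
have [x xv] := exists_parent gT uT rT rv vr.
have /implyP := pmin (@Bseq #|V| _ [:: x] V1).
rewrite /= (adj_sym T v) (up_adj xv) inE parent_out // => /(_ isT).
case: p {pV pmin} pP pu => [|y [|z p]] //= => [_ uE|].
  by rewrite uE connect0 in u_out.
rewrite andbT => vy yu _; rewrite -yu.
case/(adj_up gT)/orP: vy => // /connect1; rewrite yu => h.
by rewrite h in u_out.
Qed.

End IncreasingForests.

(** * Local description of increasing connected forests *)

Section ForestCharacterization.
Variables (d : Order.disp_t) (V : finOrderType d).
Implicit Types (G R T : {set {set V}}) (B : {set V}).

Lemma up_restr R B x y : up (restr R B) x y = [&& up R x y, x \in B & y \in B].
Proof. by rewrite /up adj_restr andbAC. Qed.

Lemma exists_block_min R B : B \in comp_partition R ->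
  exists2 r, r \in B & forall w, w \in B -> (r <= w)%O.
Proof.
move=> BR; have /set0Pn[x xB] : B != set0.
  have /and3P[_ _ n0] := comp_partitionP R.
  by apply: contraNneq n0 => <-.
exists [arg min_(r < x in B) r]%O; by case: Order.TotalTheory.arg_minP.
Qed.

(** The largest vertex of a circuit would have two smaller neighbors. *)
Lemma unique_parent_acyclic R : is_graph R -> unique_parent R -> acyclic R.
Proof.
move=> gR uR; apply/acyclicP => c cR; rewrite leqNgt; apply/negP => c3.
have [x xc xmax] : exists2 x, x \in c & forall y, y \in c -> (y <= x)%O.
  case: c c3 {cR} => // x0 c _.
  case: (@arg_maxP _ _ _ x0 [in x0 :: c] id (mem_head _ _)) => x xc xmax.
  by exists x.
case/rot_to: xc => i s cE; have xmax' y : y \in x :: s -> (y <= x)%O.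
  by rewrite -cE mem_rot; apply: xmax.
have: ucycle (adj R) (x :: s) by rewrite -cE /ucycle rot_cycle rot_uniq.
have: (2 < size (x :: s))%N by rewrite -cE size_rot.
case: s {cE} xmax' => // y s xmax' s2 /andP[/= /andP[xy]].
rewrite rcons_path => /andP[_ zx] /and3P[xys ys _].
have yx : up R y x.
  case/(adj_up gR)/orP: xy => // /up_lt.
  by rewrite ltNge xmax' // !inE eqxx orbT.
have {}zx : up R (last y s) x.
  case/(adj_up gR)/orP: zx => // /up_lt.
  by rewrite ltNge xmax' // inE mem_last orbT.
have := uR _ _ _ yx zx; case: s s2 ys {zx xys xmax'} => // z s _ ys yE.
by move: ys; rewrite yE /= mem_last.
Qed.

(** Let [u] be a smaller neighbor of [v] other than the vertex [x] preceding [v] on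
    the simple path from the root.  Either [u] is on that path, which closes a
    circuit through [x], [v] and [u]; or the path continues to [u], which makes
    [u] a descendant of [v] smaller than [v]. *)
Lemma increasing_tree_unique_parent B r T :
    acyclic T -> is_graph T -> parentless T r -> increasing B r T ->
    {in B, forall v, connect (adj T) r v} ->
  forall u u' v, v \in B -> up T u v -> up T u' v -> u = u'.
Proof.
move=> /acyclicP aT gT rT /forall_inP incT rB u0 u1 v vB u0v u1v.
case/connectP: (rB _ vB) => p0 p0P; case/shortenP: p0P => p pP pu _ vE {p0}.
case/lastP: p pP pu vE => [_ _ /= vE|p t]; first by have := rT u0; rewrite -vE u0v.
rewrite last_rcons => + + vt; rewrite -vt {vt t} => pP pu.
suff uE u : up T u v -> u = last r p by rewrite (uE u0) // (uE u1).
move=> uv; apply/eqP; have [urp|urp] := boolP (u \in r :: p).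
  (* the circuit u, p2, v; it has at most two vertices only if p2 is empty,
     in which case u is the vertex preceding v *)
  case/splitPl: urp pP pu => p1 p2 p1E.
  rewrite rcons_cat cat_path p1E => /andP[_ p2P].
  rewrite -cat_cons (lastI r p1) p1E cat_rcons cat_uniq => /and3P[_ _ p2u].
  have /aT : ucycle (adj T) (u :: rcons p2 v).
    rewrite /ucycle p2u andbT /= rcons_path p2P last_rcons /=.
    by rewrite adj_sym (up_adj uv).
  by rewrite /= size_rcons last_cat p1E; case: p2 {p2P p2u}.
have upv : u \notin r :: rcons p v.
  by rewrite -rcons_cons mem_rcons inE negb_or urp andbT lt_eqF // (up_lt uv).
have puP : path (adj T) r (rcons (rcons p v) u).
  by rewrite rcons_path pP last_rcons adj_sym (up_adj uv).
have puu : uniq (r :: rcons (rcons p v) u) by rewrite -rcons_cons rcons_uniq upv.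
have spu : (size (rcons (rcons p v) u) <= #|V|)%N.
  by apply: size_uniq_le; case/andP: puu.
have : u \in des r T v.
  rewrite inE; apply/existsP; exists (Bseq spu); apply/and4P; split=> //=.
    by rewrite last_rcons.
  by rewrite !(inE, mem_rcons) eqxx !orbT.
move/(forall_inP (incT _ vB)) => vu.
by have := up_lt uv; rewrite ltNge vu.
Qed.

(** This replaces paths, shortest walks and restrictions to components by local
    conditions on edges, which can be checked when one edge is added or removed. *)
Lemma inc_conn_forestP G R :
  reflect [/\ is_graph R, unique_parent R & linked G R] (inc_conn_forest G R).
Proof.
have restr_sub (H : {set {set V}}) B : restr H B \subset H.
  by apply/subsetP => e; rewrite inE => /andP[].
have block_adj B u v : B \in comp_partition R -> u \in B -> adj R u v -> v \in B.
  by move=> BR uB uv; rewrite (mem_comp_partition _ BR uB) connect1.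
have block_conn B x y : B \in comp_partition R -> x \in B ->
    connect (adj (restr R B)) x y = connect (adj R) x y.
  move=> BR; apply: connect_closed_restr => u v; last exact: adj_restr.
  exact: block_adj.
have block_conn_up B x y : B \in comp_partition R -> x \in B ->
    connect (up (restr R B)) x y = connect (up R) x y.
  move=> BR; apply: connect_closed_restr => u v; last exact: up_restr.
  by move=> uB /up_adj; apply: block_adj.
have block_root B r : (forall w, w \in B -> (r <= w)%O) ->
    parentless (restr R B) r.
  move=> rmin u; rewrite up_restr; apply/negP => /and3P[/up_lt + /rmin].
  by rewrite ltNge => /negbTE ->.
(* within the block B with least vertex r, the edges from the parent u of v to
   the descendants of v are the pairs of u and a vertex reached upwards from v *)
have linkedE B r : is_graph R -> B \in comp_partition R -> r \in B ->
    (forall w, w \in B -> (r <= w)%O) -> unique_parent (restr R B) ->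
    connected_wrt (restr G B) B r (restr R B) <->
    (forall u v, v \in B -> up R u v ->
       exists2 w, connect (up R) v w & adj G u w).
  move=> gR BR rB rmin uT; have gT := graphS (restr_sub R B) gR.
  have rT := block_root _ _ rmin.
  have desB v w : v \in B -> connect (up R) v w -> w \in B.
    by move=> vB /connect_upW; rewrite -(mem_comp_partition _ BR vB).
  have rv v : v \in B -> connect (adj (restr R B)) r v.
    by move=> vB; rewrite block_conn // -(mem_comp_partition _ BR rB).
  split=> [/forall_inP cG u v vB uv|cG].
    have uB : u \in B.
      by apply: block_adj BR vB _; rewrite adj_sym (up_adj uv).
    have vr : v != r.
      by apply: contraTneq (up_lt uv) => ->; rewrite ltNge rmin.
    have /implyP/(_ vr)/set0Pn[e /setIP[/imset2P[u' w pu']]] := cG _ vB.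
    rewrite (desE gT uT rT (rv _ vB)) inE block_conn_up // => vw ->.
    move: pu'; rewrite -topredE /= is_parentE ?rv // up_restr => /and3P[u'v u'B _].
    have -> : u' = u by apply: (uT _ _ v); rewrite up_restr ?u'v ?uv ?u'B ?uB.
    by rewrite inE => /andP[uw _]; exists w.
  apply/forall_inP => v vB; apply/implyP => vr.
  have [u uv] := exists_parent gT uT rT (rv _ vB) vr.
  have /and3P[uvR uB _] : [&& up R u v, u \in B & v \in B] by rewrite -up_restr.
  have [w vw uw] := cG u v vB uvR.
  apply/set0Pn; exists [set u; w]; rewrite inE; apply/andP; split.
    apply/imset2P; exists u w => //; last first.
      by rewrite (desE gT uT rT (rv _ vB)) inE block_conn_up.
    by rewrite -topredE /= is_parentE ?rv.
  by move: uw; rewrite inE /adj => -> /=; rewrite subUset !sub1set uB (desB _ _ vB vw).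
apply: (iffP and3P) => [[gR aR /forall_inP bR]|[gR uR lR]].
  have uBR B : B \in comp_partition R -> unique_parent (restr R B).
    move=> BR; have /exists_inP[r rB /andP[/forall_inP rmin]] := bR _ BR.
    case/and3P=> /and5P[gT _ _ aT /forall_inP cT] incT _ u u' v uv u'v.
    have vB : v \in B by move: uv; rewrite up_restr; case/and3P.
    apply: (increasing_tree_unique_parent aT gT (block_root _ _ rmin) incT) uv u'v => //.
    exact: (forall_inP (cT _ rB)).
  split=> // [u u' v uv u'v|u v uv].
    have vB := block_of_in R v.
    have nB t : up R t v -> t \in block_of R v.
      by rewrite inE => /up_adj; rewrite adj_sym; apply: connect1.
    apply: (uBR _ vB _ _ v); rewrite up_restr.
      by rewrite uv nB // mem_block_of.
    by rewrite u'v nB // mem_block_of.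
  have vB := block_of_in R v.
  have /exists_inP[r rB /andP[/forall_inP rmin]] := bR _ vB.
  case/and3P=> _ _ /(linkedE _ _ gR vB rB rmin (uBR _ vB)); apply=> //.
  exact: mem_block_of.
split=> //; first exact: unique_parent_acyclic.
apply/forall_inP => B BR; apply/exists_inP.
have [r rB rmin] := exists_block_min BR; exists r => //.
have gT := graphS (restr_sub R B) gR.
have uT : unique_parent (restr R B).
  move=> u u' v; rewrite !up_restr => /and3P[uv _ _] /and3P[u'v _ _].
  exact: uR uv u'v.
have rT := block_root _ _ rmin.
apply/andP; split; first exact/forall_inP.
apply/and3P; split.
- apply/and5P; split=> //.
  + by apply/forall_inP => e; rewrite inE => /andP[].
  + exact: unique_parent_acyclic.
  + apply/forall_inP => x xB; apply/forall_inP => y yB.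
    by rewrite block_conn // -(mem_comp_partition _ BR xB).
- apply/forall_inP => v vB; apply/forall_inP => w.
  rewrite (desE gT uT rT) ?inE; first exact: connect_up_le.
  by rewrite block_conn // -(mem_comp_partition _ BR rB).
- by apply/(linkedE _ _ gR BR rB rmin uT) => u v _; apply: lR.
Qed.

End ForestCharacterization.

(** * The sign-reversing involution *)

Section SignedSum.
Variables (d : Order.disp_t) (V : finOrderType d).
Implicit Types (G H R T : {set {set V}}) (B : {set V}) (r w : V).

Definition del_vertex R r : {set {set V}} := [set e in R | r \notin e].

(** In an increasing forest this is the root of the tree containing [w]; the
    definition as a minimum makes sense for any edge set. *)
Definition lowest_ancestor R w : V := [arg min_(x < w | connect (up R) x w) x]%O.

Definition toggle_edge r w R : {set V} :=
  [set r; lowest_ancestor (del_vertex R r) w].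

(** The edge to toggle is computed in [R] without [r], which toggling leaves
    unchanged; this makes [toggle] an involution. *)
Definition toggle r w R : {set {set V}} :=
  let e := toggle_edge r w R in if e \in R then R :\ e else e |: R.

Lemma del_vertex_toggle r w R : del_vertex (toggle r w R) r = del_vertex R r.
Proof.
rewrite /toggle; set e := toggle_edge _ _ _.
have re : r \in e by rewrite !inE eqxx.
by case: ifP => eR; apply/setP => f; rewrite !inE;
  have [->|] := eqVneq f e; rewrite ?re ?andbF.
Qed.

Lemma toggleK r w : involutive (toggle r w).
Proof.
move=> R; rewrite {1}/toggle /toggle_edge del_vertex_toggle.
rewrite -/(toggle_edge r w R) [toggle _ _ _]/toggle.
have [eR|eR] := boolP (toggle_edge r w R \in R).
  by rewrite setD11 setD1K.
by rewrite setU11 setU1K.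
Qed.

Lemma toggle_sign r w R : (-1) ^+ #|toggle r w R| = - (-1) ^+ #|R| :> rat.
Proof.
rewrite /toggle; set e := toggle_edge _ _ _; case: ifPn => eR.
  by rewrite (cardsD1 e R) eR exprS mulN1r opprK.
by rewrite cardsU1 eR exprS mulN1r.
Qed.

(** The toggled child [m] is the lowest ancestor of [w] apart from [r], so its only
    possible parent is [r] and parents stay unique.  The edge from [r] to [m] is
    linked by [w].  Since [r] is minimal, the paths that link the other edges of
    [R] stay above [r] and do not use the toggled edge. *)
Lemma toggle_forest H r w R :
    (forall u v, adj H u v -> (r <= u)%O) -> adj H r w -> w != r ->
  inc_conn_forest H R -> inc_conn_forest H (toggle r w R).
Proof.
move=> rmin rw wr /inc_conn_forestP[gR uR lR].
have rmin_up u v : up R u v -> (r <= u)%O by move=> /lR[x _ /rmin].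
pose R' := del_vertex R r.
have upR' x y : up R' x y = [&& up R x y, x != r & y != r].
  rewrite /up /adj !inE negb_or.
  by rewrite andbAC -!andbA ![r == _]eq_sym [(_ < _)%O && _]andbC -!andbA.
pose m := lowest_ancestor R' w.
have [mw mmin] : connect (up R') m w /\ forall x, connect (up R') x w -> (m <= x)%O.
  rewrite /m /lowest_ancestor.
  by case: (@arg_minP _ _ _ w [pred x | connect (up R') x w] id (connect0 _ _)).
have [r_le_m mr] : (r <= m)%O /\ m != r.
  case/connectP: (mw) => -[/= _ <-|z p /= /andP[]].
    by split=> //; apply: (rmin _ r); rewrite adj_sym.
  by rewrite upR' => /and3P[/rmin_up].
have rm : (r < m)%O by rewrite lt_def mr.
(* a parent of m other than r would be a lower ancestor of w avoiding r *)
have m_parent u : up R u m -> u = r.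
  move=> um; apply/eqP/negPn/negP => ur.
  have: (m <= u)%O.
    by apply: mmin; apply: connect_trans mw; rewrite connect1 // upR' um ur mr.
  by rewrite leNgt (up_lt um).
have eE : toggle_edge r w R = [set r; m] by [].
have upT x y : up (toggle r w R) x y -> up R x y \/ x = r /\ y = m.
  rewrite /toggle eE; case: ifP => _ /andP[]; rewrite /adj !inE.
    by case/andP => _ xy lxy; left; rewrite /up /adj xy.
  case/orP => [/eqP xyE lxy|xy lxy]; last by left; rewrite /up /adj xy.
  right; have: x \in [set r; m] by rewrite -xyE !inE eqxx.
  have: y \in [set r; m] by rewrite -xyE !inE eqxx orbT.
  rewrite !inE => /orP[]/eqP yE /orP[]/eqP xE //; move: lxy.
  - by rewrite xE yE ltxx.
  - by rewrite xE yE ltNge (ltW rm).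
  - by rewrite xE yE ltxx.
have upR'T x y : up R' x y -> up (toggle r w R) x y.
  rewrite -[R'](del_vertex_toggle r w R) => /andP[+ lxy]; rewrite /up lxy andbT.
  by rewrite /adj inE => /andP[].
have conR'T x y : connect (up R') x y -> connect (up (toggle r w R)) x y.
  by apply: connect_sub => a b /upR'T/connect1.
apply/inc_conn_forestP; split.
- rewrite /toggle eE; case: ifP => _.
    by apply: graphS gR; apply: subD1set.
  apply/forall_inP => e; rewrite !inE => /orP[/eqP->|].
    by rewrite cards2 [r == _]eq_sym mr.
  exact: (forall_inP gR).
- move=> u u' v /upT[uv|[-> vm]] /upT[u'v|[-> vm']] //.
  + exact: uR uv u'v.
  + by move: uv; rewrite vm' => /m_parent.
  + by move: u'v; rewrite vm => /m_parent ->.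
- move=> u v /upT[uv|[-> ->]]; last by exists w => //; apply: conR'T.
  have [y vy uy] := lR _ _ uv; exists y => //; apply: conR'T.
  have: (r < v)%O by apply: le_lt_trans (rmin_up _ _ uv) (up_lt uv).
  case/connectP: vy => p pP -> {y uy uv}; elim: p v pP => [|z p IHp] v /=.
    by rewrite connect0.
  case/andP => vz /IHp zp rv; have rz := lt_trans rv (up_lt vz).
  by apply: connect_trans (zp rz); rewrite connect1 // upR' vz !gt_eqF.
Qed.

Lemma inc_conn_forest0 R : inc_conn_forest set0 R = (R == set0).
Proof.
apply/inc_conn_forestP/eqP => [[gR _ lR]|->].
  apply/eqP/set0Pn => -[e eR]; have [u [v [uv _]]] := up_edgeP gR eR.
  by have [w _] := lR _ _ uv; rewrite /adj inE.
by split=> [|u u' v|u v]; rewrite /up /adj ?inE //;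
  apply/forall_inP => e; rewrite inE.
Qed.

(** If [G] has no edge, only the empty forest is [G]-connected; otherwise toggling at
    the smallest non-isolated vertex of [G] cancels all terms. *)
Lemma forest_sign_sum G : is_graph G ->
  \sum_(R : {set {set V}} | inc_conn_forest G R) (-1) ^+ #|R|
    = (G == set0)%:R :> rat.
Proof.
move=> gG; have [->|/set0Pn[e eG]] := eqVneq G set0.
  rewrite (eq_bigl (pred1 set0)) => [|R]; last exact: inc_conn_forest0.
  by rewrite big_pred1_eq cards0.
have [x [y [xy _]]] := up_edgeP gG eG.
pose touched r := [exists z, adj G r z].
have tx : touched x by apply/existsP; exists y; apply: up_adj.
case: (@arg_minP _ _ _ x touched id tx) => r /existsP[w rw] rmin.
have {}rmin u v : adj G u v -> (r <= u)%O.
  by move=> uv; apply: rmin; apply/existsP; exists v.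
have wr : w != r by rewrite eq_sym (adj_neq gG rw).
set S := \sum_(_ | _) _; suff: S = - S.
  by move/esym/eqP; rewrite eqNr => /eqP.
rewrite {1}/S (reindex_inj (inv_inj (toggleK r w))) -sumrN.
apply: eq_big => [R|R _]; last exact: toggle_sign.
apply/idP/idP; last exact: toggle_forest.
by rewrite -{2}(toggleK r w R); apply: toggle_forest.
Qed.

End SignedSum.

(** * Proper colorings as signed sums of forests *)

Section MonochromaticEdges.
Variables (V : finType) (C : eqType).
Implicit Types (G R P : {set {set V}}) (B : {set V}) (kappa : V -> C).

Definition constant_on_blocks P kappa : bool :=
  [forall B in P, forall x in B, forall y in B, kappa x == kappa y].

Definition mono_edges kappa G : {set {set V}} :=
  [set e in G | [forall x in e, forall y in e, kappa x == kappa y]].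

Lemma adj_mono kappa G x y :
  adj (mono_edges kappa G) x y = adj G x y && (kappa x == kappa y).
Proof.
rewrite /adj inE; case: (_ \in G) => //=.
apply/forall_inP/eqP => [/(_ x)|xy u].
  by rewrite !inE eqxx => /(_ isT)/forall_inP/(_ y); rewrite !inE eqxx orbT => /(_ isT)/eqP.
by rewrite !inE => /orP[]/eqP ->; apply/forall_inP => v;
  rewrite !inE => /orP[]/eqP ->; rewrite ?xy.
Qed.

Lemma constant_on_compP kappa R :
  reflect (forall x y, adj R x y -> kappa x = kappa y)
          (constant_on_blocks (comp_partition R) kappa).
Proof.
apply: (iffP forall_inP) => [cR x y xy|cR B BR].
  have /forall_inP/(_ _ (mem_block_of R x))/forall_inP := cR _ (block_of_in R x).
  by move=> /(_ y); rewrite inE connect1 // => /(_ isT)/eqP.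
apply/forall_inP => x xB; apply/forall_inP => y.
rewrite (mem_comp_partition _ BR xB) => /connectP[p pP ->] {xB}; apply/eqP.
by elim: p x pP => //= z p IHp x /andP[/cR -> /IHp].
Qed.

End MonochromaticEdges.

Section Colorings.
Variables (d : Order.disp_t) (V : finOrderType d) (C : eqType).
Implicit Types (G R : {set {set V}}) (kappa : V -> C).

Lemma proper_coloring_mono kappa G : is_graph G ->
  proper_coloring G kappa = (mono_edges kappa G == set0).
Proof.
move=> gG; apply/forallP/eqP => [pG|m0 x].
  apply/eqP/set0Pn => -[e eM].
  have gM : is_graph (mono_edges kappa G).
    by apply: graphS gG; apply/subsetP => f; rewrite inE => /andP[].
  have [u [v [/up_adj + _]]] := up_edgeP gM eM.
  rewrite adj_mono => /andP[uv]; apply/negP.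
  by have /forallP/(_ v)/implyP := pG u; apply.
apply/forallP => y; apply/implyP => xy; apply/negP => kxy.
have: adj (mono_edges kappa G) x y by rewrite adj_mono xy.
by rewrite m0 /adj inE.
Qed.

(** A forest linked by monochromatic edges of [G] is itself monochromatic, from the
    top down: the link of [u -> v] gives some [w] of the color of [u], and the
    edges from [v] to [w] start above [u].  Conversely, if the components of [R]
    are monochromatic, so is every edge of [G] that links [R]. *)
Lemma inc_conn_forest_mono kappa G R :
  inc_conn_forest (mono_edges kappa G) R
    = inc_conn_forest G R && constant_on_blocks (comp_partition R) kappa.
Proof.
apply/inc_conn_forestP/andP => [[gR uR lR]|[/inc_conn_forestP[gR uR lR]]].
  split.
    apply/inc_conn_forestP; split=> // u v /lR[w vw].
    by rewrite adj_mono => /andP[uw _]; exists w.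
  suff up_mono u v : up R u v -> kappa u = kappa v.
    apply/constant_on_compP => x y /(adj_up gR)/orP[/up_mono//|/up_mono ->//].
  (* induction on the number of vertices above u *)
  have [n] := ubnP #|[set x | u < x]%O|; elim: n u v => // n IHn u v un uv.
  have [w vw] := lR _ _ uv; rewrite adj_mono => /andP[_ /eqP ->].
  have: (u < v)%O := up_lt uv.
  case/connectP: vw => p pP -> {uv}; elim: p v pP => //= z p IHp v /andP[vz zp] uv.
  rewrite IHp ?(lt_trans uv (up_lt vz)) //; apply/esym/IHn => //.
  rewrite ltnS in un; apply: leq_trans un; apply: proper_card.
  apply/properP; split; last by exists v; rewrite !inE ?uv ?ltxx.
  by apply/subsetP => x; rewrite !inE; apply: lt_trans.
move/constant_on_compP => cR; split=> // u v uv.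
have [w vw uw] := lR _ _ uv; exists w => //; rewrite adj_mono uw /=.
rewrite (cR _ _ (up_adj uv)); case/connectP: vw => p pP -> {uv uw}.
by elim: p v pP => //= z p IHp v /andP[/up_adj/cR -> /IHp].
Qed.

Lemma proper_coloring_forests kappa G : is_graph G ->
  (proper_coloring G kappa)%:R
    = \sum_(R : {set {set V}} | inc_conn_forest G R
         && constant_on_blocks (comp_partition R) kappa) (-1) ^+ #|R| :> rat.
Proof.
move=> gG; rewrite proper_coloring_mono // -forest_sign_sum.
  by apply: eq_bigl => R; apply: inc_conn_forest_mono.
by apply: graphS gG; apply/subsetP => e; rewrite inE => /andP[].
Qed.

End Colorings.

(** * Summing over colorings that are constant on blocks *)

Section BlockwiseConstant.
Variables (V : finType).
Implicit Types (P : {set {set V}}).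

(** Colorings constant on the blocks of [P] are functions on [P], so the sum is the
    expanded product.  With variables for [F j] this is the factorization of
    [p_lambda], and with [F j = 1] it counts these colorings. *)
Lemma sum_constant_on_blocks (K : comNzRingType) (J : finType) P (F : J -> K) :
  partition P [set: V] ->
  \sum_(kappa : {ffun V -> J} | constant_on_blocks P kappa)
      \prod_v F (kappa v)
    = \prod_(B in P) \sum_j F j ^+ #|B|.
Proof.
move=> partP; have /and3P[/eqP coverP tiP n0] := partP.
have covered v : v \in cover P by rewrite coverP inE.
pose block v : {B in P} := Sub (pblock P v) (pblock_mem (covered v)).
have nonempty (B : {B in P}) : exists v, v \in val B.
  by apply/set0Pn; apply: contraNneq n0 => <-; apply: valP.
pose rep B := xchoose (nonempty B).
have repK : cancel rep block.
  move=> B; apply: val_inj => /=.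
  exact: def_pblock (valP B) (xchooseP (nonempty B)).
have mem_block v (B : {B in P}) : (v \in val B) = (block v == B).
  rewrite -(inj_eq val_inj) /=; apply/idP/eqP => [|<-]; last by rewrite mem_pblock.
  exact: def_pblock (valP B).
rewrite (big_sub P) bigA_distr_bigA /=.
rewrite (reindex_onto (fun g : {ffun {B in P} -> J} => [ffun v => g (block v)])
                      (fun kappa => [ffun B => kappa (rep B)])); last first.
  move=> kappa kP; apply/ffunP => v; rewrite !ffunE.
  have vB : v \in val (block v) by rewrite mem_block.
  have := forall_inP kP _ (valP (block v)).
  move/forall_inP/(_ _ vB)/forall_inP/(_ (rep (block v))).
  by rewrite mem_block repK eqxx => /(_ isT)/eqP.
apply: eq_big => [g|g _]; last first.
  rewrite (partition_big block predT) //=; apply: eq_bigr => B _.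
  rewrite (eq_bigr (fun=> F (g B))) => [|v /eqP <-]; last by rewrite ffunE.
  by rewrite prodr_const; congr (_ ^+ _); apply: eq_card => v; rewrite mem_block.
have -> : [ffun B => [ffun v => g (block v)] (rep B)] == g.
  by apply/eqP/ffunP => B; rewrite !ffunE repK.
rewrite andbT; apply/forall_inP => B BP; apply/forall_inP => x xB.
apply/forall_inP => y yB; rewrite !ffunE.
by rewrite (_ : block x = block y) //; apply: val_inj; rewrite /= !(def_pblock tiP BP).
Qed.

Lemma card_constant_on_blocks (J : finType) P : partition P [set: V] ->
  #|[set kappa : {ffun V -> J} | constant_on_blocks P kappa]| = (#|J| ^ #|P|)%N.
Proof.
move=> partP; apply/eqP; rewrite -(eqr_nat rat) natrX -sum1dep_card natr_sum.
have E := sum_constant_on_blocks (fun _ : J => 1 : rat) partP.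
rewrite (eq_bigr (fun _ : {ffun V -> J} => \prod_(v : V) 1)) => [|kappa _]; last first.
  by rewrite big1_eq.
apply/eqP; rewrite E.
rewrite (eq_bigr (fun=> #|J|%:R)) ?prodr_const // => B _.
by rewrite (eq_bigr (fun=> 1)) => [|j _]; rewrite ?expr1n ?sumr_const.
Qed.

End BlockwiseConstant.

(** * Edges, components and signs of forests *)

Section Counting.
Variables (d : Order.disp_t) (V : finOrderType d).
Implicit Types (G R P : {set {set V}}) (B : {set V}).

Lemma ordered_pair_inj (u v u' v' : V) : (u < v)%O -> (u' < v')%O ->
  [set u; v] = [set u'; v'] -> u = u' /\ v = v'.
Proof.
move=> uv uv' E; have: v' \in [set u; v] by rewrite E set22.
have: u' \in [set u; v] by rewrite E set21.
rewrite !inE => /orP[]/eqP u'E /orP[]/eqP v'E //; move: uv';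
  by rewrite u'E v'E ?ltxx // lt_gtF.
Qed.

(** Edges correspond to the vertices with a parent, by taking the upper endpoint;
    components correspond to the vertices without, by taking the minimum. *)
Lemma forest_card R : is_graph R -> unique_parent R ->
  (#|R| + #|comp_partition R|)%N = #|V|.
Proof.
move=> gR uR; pose roots := [set v | [forall u, ~~ up R u v]].
pose parent v := odflt v [pick u | up R u v].
have parentP v : v \in ~: roots -> up R (parent v) v.
  rewrite !inE negb_forall => /existsP[u]; rewrite negbK => uv.
  by rewrite /parent; case: pickP => [//|/(_ u)]; rewrite uv.
have RE : R = [set [set parent v; v] | v in ~: roots].
  apply/setP => e; apply/idP/imsetP => [eR|[v /parentP/up_adj vR ->]] //.
  have [u [v [uv ->]]] := up_edgeP gR eR.
  have vnr : v \in ~: roots.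
    by rewrite !inE negb_forall; apply/existsP; exists u; rewrite uv.
  by exists v => //; rewrite (uR _ _ _ (parentP _ vnr) uv).
have cR : #|R| = #|~: roots|.
  rewrite {1}RE card_in_imset // => v w /parentP/up_lt vp /parentP/up_lt wp.
  by case/(ordered_pair_inj vp wp).
have compE : comp_partition R = [set block_of R v | v in roots].
  apply/setP => B; apply/idP/imsetP => [BR|[v _ ->]]; last exact: block_of_in.
  have [r rB rmin] := exists_block_min BR; exists r.
    rewrite inE; apply/forallP => u; apply/negP => ur.
    have := up_lt ur; rewrite ltNge rmin //.
    by rewrite (mem_comp_partition _ BR rB) connect1 // adj_sym (up_adj ur).
  by apply/setP => x; rewrite (mem_comp_partition _ BR rB) inE.
have cC : #|comp_partition R| = #|roots|.
  rewrite compE card_in_imset // => v w; rewrite !inE => /forallP vr /forallP wr E.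
  have vw : connect (adj R) v w.
    by have := mem_block_of R w; rewrite -E inE.
  have wv : connect (adj R) w v by rewrite connect_adj_sym.
  apply/eqP; rewrite eq_le !(connect_up_le (connect_up_root gR uR _ _)) //.
by rewrite cR cC addnC cardsC.
Qed.

Lemma inc_conn_forest_card G R : inc_conn_forest G R ->
  (#|R| + #|comp_partition R|)%N = #|V|.
Proof. by case/inc_conn_forestP => gR uR _; apply: forest_card. Qed.

Lemma signed_forest_count G q (Q : pred {set {set V}}) :
    (forall R, inc_conn_forest G R -> Q R -> #|comp_partition R| = q) ->
  \sum_(R : {set {set V}} | inc_conn_forest G R && Q R) (-1) ^+ #|R|
    = (-1) ^+ (#|V| - q) * #|[set R | inc_conn_forest G R & Q R]|%:R :> rat.
Proof.
move=> cQ; rewrite (eq_bigr (fun=> (-1) ^+ (#|V| - q))) => [|R /andP[fR QR]].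
  by rewrite sumr_const mulr_natr; congr (_ *+ _); apply: eq_card => R; rewrite inE.
by rewrite -(cQ _ fR QR) -(inc_conn_forest_card fR) addnK.
Qed.

(** The expansions of [chi_G], [X_G] and [Y_G] are instances of this linear form of
    [proper_coloring_forests], for different weights [F]. *)
Lemma sum_proper_colorings (A : lmodType rat) (J : finType) G
    (F : {ffun V -> J} -> A) : is_graph G ->
  \sum_(kappa : {ffun V -> J} | proper_coloring G kappa) F kappa
    = \sum_(R : {set {set V}} | inc_conn_forest G R) (-1) ^+ #|R| *:
        \sum_(kappa : {ffun V -> J} | constant_on_blocks (comp_partition R) kappa)
           F kappa.
Proof.
move=> gG; transitivity
  (\sum_(kappa : {ffun V -> J}) (proper_coloring G kappa)%:R *: F kappa).
  rewrite big_mkcond; apply: eq_bigr => kappa _.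
  by case: ifP; rewrite ?scale1r ?scale0r.
under eq_bigr => kappa _ do rewrite proper_coloring_forests // scaler_suml.
rewrite (exchange_big_dep (inc_conn_forest G)) /=; last by move=> kappa R _ /andP[].
apply: eq_bigr => R fR; rewrite scaler_sumr; apply: eq_bigl => kappa.
by rewrite fR.
Qed.

End Counting.

(** * Trees as forests with one component *)

Section Trees.
Variables (d : Order.disp_t) (V : finOrderType d).
Implicit Types (G R T : {set {set V}}) (B : {set V}).

Lemma comp_partition1P T :
  reflect (comp_partition T = [set [set: V]]) (#|comp_partition T| == 1%N).
Proof.
apply: (iffP cards1P) => [[B TB]|->]; last by exists [set: V].
by have /and3P[/eqP <- _ _] := comp_partitionP T; rewrite TB /cover big_set1.
Qed.

Lemma inc_conn_treeP G r T :
  reflect [/\ inc_conn_forest G T, #|comp_partition T| = 1%N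
            & forall w, (r <= w)%O]
          (inc_conn_tree G [set: V] r T).
Proof.
apply: (iffP idP) => [treeT|[/and3P[gT aT /forall_inP bT] /eqP/comp_partition1P T1 rmin]].
  have /and3P[/and5P[gT _ _ aT /forall_inP cT] /forall_inP/(_ r) incr _] := treeT.
  have conT x y : connect (adj T) x y by apply: (forall_inP (cT x _)); rewrite inE.
  have rmin w : (r <= w)%O.
    case/connectP: (conT r w) => p0 p0P; case/shortenP: p0P => p pP pu _ wE.
    have sp : (size p <= #|V|)%N by apply: size_uniq_le; case/andP: pu.
    apply: (forall_inP (incr _)); rewrite ?inE //; apply/existsP; exists (Bseq sp).
    by apply/and4P; split=> //=; rewrite ?wE ?inE ?eqxx.
  have T1 : comp_partition T = [set [set: V]].
    have blockT B x : B \in comp_partition T -> x \in B -> B = [set: V].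
      by move=> BT xB; apply/setP => y; rewrite (mem_comp_partition _ BT xB) conT inE.
    apply/setP => B; rewrite inE; apply/idP/eqP => [BT|->].
      have /set0Pn[x xB] : B != set0.
        by have /and3P[_ _] := comp_partitionP T; apply: contraNneq => <-.
      exact: blockT BT xB.
    by rewrite -(blockT _ _ (block_of_in T r) (mem_block_of T r)) block_of_in.
  split=> //; last by rewrite T1 cards1.
  apply/and3P; split=> //; apply/forall_inP => B; rewrite T1 inE => /eqP ->.
  apply/exists_inP; exists r; first by rewrite inE.
  by rewrite !restrT treeT andbT; apply/forall_inP.
have := bT [set: V]; rewrite T1 inE eqxx => /(_ isT)/exists_inP[r' _].
rewrite !restrT => /andP[/forall_inP rmin' treeT].
by have -> : r = r' by apply/le_anti; rewrite rmin rmin' ?inE.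
Qed.

(** The root is not an additional choice: it is the smallest vertex. *)
Lemma card_inc_conn_trees G :
  #|[set rT : V * {set {set V}} | inc_conn_tree G [set: V] rT.1 rT.2]|
  = #|[set R : {set {set V}} | inc_conn_forest G R & #|comp_partition R| == 1%N]|.
Proof.
rewrite -(card_in_imset (f := snd)) => [|[r T] [r' T']]; last first.
  rewrite !inE /= => /inc_conn_treeP[_ _ rmin] /inc_conn_treeP[_ _ rmin'] ->.
  by congr pair; apply/le_anti; rewrite rmin rmin'.
apply: eq_card => T; rewrite inE; apply/imsetP/andP => [[[r T']]|[fT T1]].
  by rewrite inE => /inc_conn_treeP[fT /eqP T1 _] ->.
have [|r _ rmin] := @exists_block_min _ _ T [set: V].
  by rewrite (comp_partition1P _ T1) inE.
exists (r, T) => //; rewrite inE; apply/inc_conn_treeP; split=> //=.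
  exact/eqP.
by move=> w; apply: rmin; rewrite inE.
Qed.

End Trees.

(** * The chromatic polynomial *)

Section ChromaticPolynomial.
Variables (d : Order.disp_t) (V : finOrderType d).
Implicit Types (G R : {set {set V}}).

Definition forest_poly G : {poly rat} :=
  \sum_(R : {set {set V}} | inc_conn_forest G R)
    (-1) ^+ #|R| *: 'X^#|comp_partition R|.

Lemma forest_poly_chromatic G : is_graph G -> chromatic_polynomial G (forest_poly G).
Proof.
move=> gG k; rewrite horner_sum -sum1dep_card natr_sum.
rewrite (@sum_proper_colorings _ _ rat^o _ _ (fun=> 1)) //.
apply: eq_bigr => R fR; rewrite hornerZ hornerXn; congr (_ * _).
have := card_constant_on_blocks 'I_k (comp_partitionP R); rewrite card_ord -natrX => <-.
by rewrite -sum1dep_card natr_sum.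
Qed.

Lemma coef_forest_poly G q :
  (forest_poly G)`_q
    = (-1) ^+ (#|V| - q)
      * #|[set R | inc_conn_forest G R & #|comp_partition R| == q]|%:R.
Proof.
rewrite coef_sum -signed_forest_count => [|R _ /eqP //].
rewrite [RHS]big_mkcondr; apply: eq_bigr => R _; rewrite coefZ coefXn eq_sym.
by case: eqP; rewrite ?mulr1 ?mulr0.
Qed.

End ChromaticPolynomial.

Lemma chromatic_polynomial_unique (V : finType) (G : {set {set V}}) p q :
  chromatic_polynomial G p -> chromatic_polynomial G q -> p = q.
Proof.
move=> pG qG; apply/eqP; rewrite -subr_eq0; apply: contraT => pq0.
pose rs : seq rat := [seq k%:R | k <- iota 0 (size (p - q))].
have /(max_poly_roots pq0) : all (root (p - q)) rs.
  by apply/allP => _ /mapP[k _ ->]; rewrite rootE hornerD hornerN pG qG subrr.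
rewrite size_map size_iota ltnn => -> //.
by rewrite map_inj_uniq ?iota_uniq // => i j /eqP; rewrite eqr_nat => /eqP.
Qed.

(** Induction on [rk]: in the equation of [i], the differences [c j - c' j] with
    [j != i] are multiplied by 0 or have smaller rank. *)
Lemma triangular_system (I : eqType) (s : seq I) (rk : I -> nat)
    (A : I -> I -> rat) (c c' : I -> rat) :
    uniq s ->
    {in s, forall i, \sum_(j <- s) c j * A j i = \sum_(j <- s) c' j * A j i} ->
    (forall i, A i i != 0) ->
    {in s &, forall i j, A j i != 0 -> j != i -> (rk j < rk i)%N} ->
  {in s, c =1 c'}.
Proof.
move=> us sys Aii tri i; have [n] := ubnP (rk i).
elim: n i => // n IHn i rin si.
have: \sum_(j <- s) (c j - c' j) * A j i = 0.
  by under eq_bigr => j _ do rewrite mulrBl; rewrite sumrB sys ?subrr.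
rewrite (bigD1_seq i) //= big_seq_cond big1 ?addr0 => [/eqP|j /andP[sj ji]].
  by rewrite mulf_eq0 (negbTE (Aii i)) orbF subr_eq0 => /eqP.
have [->|Aji] := eqVneq (A j i) 0; first by rewrite mulr0.
by rewrite IHn ?subrr ?mul0r // (leq_trans (tri _ _ si sj Aji ji)).
Qed.

(** * Monomials *)

Lemma malg_prodU (R : comNzRingType) (M : monomType) (I : Type) (s : seq I)
    (P : pred I) (F : I -> M) :
  \prod_(i <- s | P i) << F i >> = << \big[mmul/mone]_(i <- s | P i) F i >>
    :> {malg R[M]}.
Proof.
elim/big_rec2: _ => [|i m a _ ->] //.
by rewrite malgM_def fgmulUU mulr1.
Qed.

Lemma malg_expU (R : comNzRingType) (M : monomType) (m : M) n :
  << m >> ^+ n = << \big[mmul/mone]_(i < n) m >> :> {malg R[M]}.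
Proof. by rewrite -malg_prodU prodr_const card_ord. Qed.

Lemma eq_mcoeff_sumZ (M : monomType) (I : Type) (s : seq I) (c c' : I -> rat)
    (F : I -> {malg rat[M]}) m :
    \sum_(i <- s) c i *: F i = \sum_(i <- s) c' i *: F i ->
  \sum_(i <- s) c i * (F i)@_m = \sum_(i <- s) c' i * (F i)@_m.
Proof.
have coefE b : (\sum_(i <- s) b i *: F i)@_m = \sum_(i <- s) b i * (F i)@_m.
  by rewrite raddf_sum; apply: eq_bigr => i _; apply: mcoeffZ.
by move=> E; rewrite -!coefE E.
Qed.

Lemma cmonom_prodE (J : choiceType) (I : Type) (s : seq I) (P : pred I)
    (F : I -> {cmonom J}) j :
  (\big[mmul/mone]_(i <- s | P i) F i : {cmonom J}) j
    = (\sum_(i <- s | P i) F i j)%N.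
Proof.
elim/big_rec2: _ => [|i n m _ <-]; first exact: cm1.
exact: cmM.
Qed.

(** * The chromatic symmetric function in noncommuting variables *)

Section Words.
Variables (d : Order.disp_t) (V : finOrderType d).

Definition word_monom N (i : V -> 'I_N) : {fmonom 'I_N} :=
  \big[mmul/mone]_(v <- sort <=%O (enum V)) fmu (i v).

Lemma wordE N (i : V -> 'I_N) : word i = << word_monom i >>.
Proof. exact: malg_prodU. Qed.

Lemma word_monom_inj N (i j : V -> 'I_N) : word_monom i = word_monom j -> i =1 j.
Proof.
have wE (k : V -> 'I_N) : word_monom k = map k (sort <=%O (enum V)) :> seq 'I_N.
  rewrite /word_monom; elim: (sort _ _) => [|v s IHs].
    by rewrite big_nil fm1.
  by rewrite big_cons fmM fmU IHs.
move=> /(congr1 (fun m : {fmonom 'I_N} => m : seq 'I_N)).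
by rewrite !wE => /eq_in_map ij v; apply: ij; rewrite mem_sort mem_enum.
Qed.

Lemma coef_psum_setpart (P : setpart V) N (kappa : {ffun V -> 'I_N}) :
  (psum_setpart P N)@_(word_monom kappa)
    = (constant_on_blocks (val P) kappa)%:R.
Proof.
rewrite /psum_setpart raddf_sum /=.
rewrite (eq_bigr (fun i : {ffun V -> 'I_N} => (i == kappa)%:R)) => [|i _]; last first.
  rewrite wordE mcoeffU1; congr (nat_of_bool _)%:R; apply/eqP/eqP => [|-> //].
  by move/word_monom_inj/ffunP.
rewrite big_mkcond (bigD1 kappa) //= eqxx big1 ?addr0 => [|i /negbTE ->].
  by rewrite -/(constant_on_blocks (val P) kappa); case: (constant_on_blocks _ _).
exact: if_same.
Qed.

(** The graph of the equivalence relation of [P]: its inclusion order is the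
    refinement order, and its cardinality serves as a rank for triangularity. *)
Definition block_pairs (P : {set {set V}}) : {set V * V} :=
  [set xy | xy.2 \in pblock P xy.1].

Lemma block_pairs_inj : {in [pred P | partition P [set: V]] &, injective block_pairs}.
Proof.
move=> P Q /= pP pQ PQ.
rewrite -(equivalence_partition_pblock pP) -(equivalence_partition_pblock pQ).
apply: eq_in_imset => x _; apply/setP => y; rewrite !inE.
by have /setP/(_ (x, y)) := PQ; rewrite !inE.
Qed.

(** Take a coloring [kappa Q] whose color classes are exactly the blocks of [Q].  Its
    word occurs in [p_P] only when [P] refines [Q], so that the family is
    triangular for refinement. *)
Lemma psum_setpart_free (c c' : setpart V -> rat) :
  (forall N, \sum_(P : setpart V) c P *: psum_setpart P N
     = \sum_(P : setpart V) c' P *: psum_setpart P N) -> c =1 c'.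
Proof.
(* the blocks themselves are the colors, whence the number of variables *)
pose kappa (Q : setpart V) : {ffun V -> 'I_#|{set V}|} :=
  [ffun v => enum_rank (pblock (val Q) v)].
have kappaE (P Q : setpart V) : constant_on_blocks (val P) (kappa Q)
    = (block_pairs (val P) \subset block_pairs (val Q)).
  have /and3P[/eqP cP tP _] := valP P; have /and3P[/eqP cQ tQ _] := valP Q.
  have inQ v : v \in pblock (val Q) v by rewrite mem_pblock cQ inE.
  have inP v : v \in pblock (val P) v by rewrite mem_pblock cP inE.
  apply/forall_inP/subsetP => [constP [x y]|sPQ B PB].
    rewrite !inE /= => xy.
    have PB : pblock (val P) x \in val P by apply: pblock_mem; rewrite cP inE.
    have /forall_inP/(_ _ (inP x))/forall_inP/(_ _ xy) := constP _ PB.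
    by rewrite !ffunE (inj_eq enum_rank_inj) => /eqP ->.
  apply/forall_inP => x xB; apply/forall_inP => y yB.
  rewrite !ffunE (inj_eq enum_rank_inj); apply/eqP/esym/same_pblock => //.
  by have := sPQ (x, y); rewrite !inE /= (def_pblock tP PB xB); apply.
move=> cc'; have := @triangular_system (setpart V) (index_enum (setpart V))
  (fun P => #|block_pairs (val P)|)
  (fun P Q => (psum_setpart P #|{set V}|)@_(word_monom (kappa Q))) c c'.
move=> + P; move=> /(_ _ _ _ _ P (mem_index_enum P)); apply.
- exact: index_enum_uniq.
- by move=> Q _; apply: eq_mcoeff_sumZ (cc' _).
- by move=> Q; rewrite coef_psum_setpart kappaE subxx oner_eq0.
move=> Q R _ _; rewrite coef_psum_setpart kappaE => sRQ RQ.
apply: proper_card; rewrite properEneq.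
case: (_ \subset _) sRQ; rewrite ?eqxx ?andbT // => _.
apply: contra RQ => /eqP E; apply/eqP/val_inj.
exact: block_pairs_inj (valP R) (valP Q) E.
Qed.

Definition comp_setpart (R : {set {set V}}) : setpart V :=
  Sub (comp_partition R) (comp_partitionP R).

Lemma chrom_nsym_forests (G : {set {set V}}) N : is_graph G ->
  chrom_nsym G N
    = \sum_(R : {set {set V}} | inc_conn_forest G R)
        (-1) ^+ #|R| *: psum_setpart (comp_setpart R) N.
Proof. exact: sum_proper_colorings. Qed.

Definition nsym_coef (G : {set {set V}}) : {ffun setpart V -> rat} :=
  [ffun P : setpart V => (-1) ^+ (#|V| - #|val P|)
    * #|[set R | inc_conn_forest G R & comp_partition R == val P]|%:R].

Lemma nsym_coef_expansion (G : {set {set V}}) : is_graph G ->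
  psum_setpart_expansion (chrom_nsym G) (nsym_coef G).
Proof.
move=> gG N; rewrite chrom_nsym_forests // (partition_big comp_setpart predT) //=.
apply: eq_bigr => P _; rewrite ffunE -signed_forest_count => [|R _ /eqP -> //].
rewrite scaler_suml; apply: eq_big => R; first by rewrite -val_eqE.
by case/andP => _ /eqP ->.
Qed.

Lemma psum_setpart_expansion_unique (F : noncomm_series) (c c' : {ffun setpart V -> rat}) :
  psum_setpart_expansion F c -> psum_setpart_expansion F c' -> c = c'.
Proof.
move=> cF cF'; apply/ffunP; apply: psum_setpart_free => N.
exact: etrans (esym (cF N)) (cF' N).
Qed.

End Words.

(** * Linear independence of the power sums of partitions *)

Section PowerSums.

(** Expanding the product of the power sums of the parts of [s] means choosing a
    variable [f i] for each part; this is the resulting monomial.  For [f]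
    the identity it is the monomial whose exponents are the parts of [s]. *)
Definition part_monom (s : seq nat) N (f : 'I_(size s) -> 'I_N) : {cmonom 'I_N} :=
  \big[mmul/mone]_(i < size s) \big[mmul/mone]_(k < nth 0%N s i) ucm (f i).

Lemma part_monomE s N (f : 'I_(size s) -> 'I_N) j :
  part_monom f j = (\sum_(i < size s | f i == j) nth 0%N s i)%N.
Proof.
rewrite cmonom_prodE [RHS]big_mkcond; apply: eq_bigr => i _.
rewrite cmonom_prodE sum_nat_const card_ord ucmE.
by case: eqP; rewrite ?muln1 ?muln0.
Qed.

Lemma psum_partE (lam : intpart) N :
  psum_part lam N
    = \sum_(f : {ffun 'I_(size (val lam)) -> 'I_N}) << part_monom f >>.
Proof.
rewrite /psum_part (big_nth 0%N) big_mkord /psum bigA_distr_bigA.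
apply: eq_bigr => f _; rewrite -malg_prodU; apply: eq_bigr => i _.
exact: malg_expU.
Qed.

Lemma coef_psum_part (lam : intpart) N (m : {cmonom 'I_N}) :
  (psum_part lam N)@_m
    = #|[set f : {ffun 'I_(size (val lam)) -> 'I_N} | part_monom f == m]|%:R.
Proof.
rewrite psum_partE raddf_sum /= -sum1dep_card natr_sum [RHS]big_mkcond.
by apply: eq_bigr => f _; rewrite mcoeffU1; case: eqP.
Qed.

Lemma map_nth_ord (s : seq nat) : [seq nth 0%N s i | i : 'I_(size s)] = s.
Proof.
rewrite /image_mem (map_comp (nth 0%N s) val) val_enum_ord.
exact: mkseq_nth.
Qed.

(** If the monomial with exponents [lam] occurs in [p_mu], then every part of [lam] is
    a sum of parts of [mu].  Parts of [lam] are positive, so [f] is surjective;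
    were the numbers of parts equal, [f] would be a bijection and the two
    partitions rearrangements of each other. *)
Lemma part_refinement (lam mu : intpart)
    (f : 'I_(size (val mu)) -> 'I_(size (val lam))) :
    part_monom f = part_monom (s := val lam) id -> mu != lam ->
  (size (val lam) < size (val mu))%N.
Proof.
move=> fE mulam; have fibre j : (\sum_(i | f i == j) nth 0 (val mu) i)%N = nth 0%N (val lam) j.
  by rewrite -part_monomE fE part_monomE big_pred1_eq.
have /andP[slam /allP plam] := valP lam; have /andP[smu _] := valP mu.
have surj j : j \in codom f.
  have: (0 < nth 0 (val lam) j)%N by apply/plam/mem_nth.
  rewrite -fibre; apply: contraLR => jf; rewrite -eqn0Ngt.
  rewrite big1 // => i /eqP fi; by rewrite -fi codom_f in jf.
have cf : #|codom f| = size (val lam).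
  by rewrite -[RHS]card_ord; apply: eq_card => j; rewrite surj.
have szf : size (codom f) = size (val mu) by rewrite size_codom card_ord.
have le_size := card_size (codom f); rewrite cf szf in le_size.
rewrite ltn_neqAle le_size andbT.
apply: contra mulam => /eqP szE.
have uf : uniq (codom f) by apply/card_uniqP; rewrite cf szf szE.
have injf : injective f by apply/injectiveP.
have valf (i : 'I_(size (val mu))) : nth 0%N (val mu) i = nth 0%N (val lam) (f i).
  by rewrite -fibre (big_pred1 i) // => k; rewrite (inj_eq injf).
apply/eqP/val_inj; apply: (sorted_eq (leT := geq)) => //.
- by move=> a b c /= ab ca; apply: leq_trans ca ab.
- by move=> a b /= ab; apply: anti_leq; rewrite andbC.
rewrite -(map_nth_ord (val mu)) -(map_nth_ord (val lam)) /image_mem.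
rewrite (eq_map valf) (map_comp (fun j : 'I_(size (val lam)) => nth 0%N (val lam) j) f).
apply/perm_map/uniq_perm; rewrite ?enum_uniq // => j.
by rewrite mem_enum inE; apply: surj.
Qed.

(** Triangularity for the number of parts, by [part_refinement]; the diagonal
    coefficients are positive because the identity contributes. *)
Lemma psum_part_free (s : seq intpart) (c c' : intpart -> rat) : uniq s ->
    (forall N, \sum_(lam <- s) c lam *: psum_part lam N
       = \sum_(lam <- s) c' lam *: psum_part lam N) ->
  {in s, c =1 c'}.
Proof.
move=> us cc'; pose M := (\max_(lam <- s) size (val lam))%N.
have sM lam : lam \in s -> (size (val lam) <= M)%N.
  by move=> slam; rewrite /M (big_rem lam) //= leq_maxl.
apply: (triangular_system (rk := fun lam => (M - size (val lam))%N)
  (A := fun mu lam => (psum_part mu (size (val lam)))@_(part_monom (s := val lam) id))) => //.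
- by move=> lam _; apply: eq_mcoeff_sumZ (cc' _).
- move=> lam; rewrite coef_psum_part pnatr_eq0 -lt0n.
  apply/card_gt0P; exists [ffun i => i]; rewrite inE; apply/eqP.
  by apply: eq_bigr => i _; rewrite ffunE.
move=> lam mu _ smu; rewrite coef_psum_part pnatr_eq0 -lt0n.
case/card_gt0P => f; rewrite inE => /eqP/part_refinement h /h lt.
exact: ltn_sub2l (leq_trans lt (sM _ smu)) lt.
Qed.

(** Two expansions may have different supports; to be compared they are written over
    a common one. *)
Lemma psum_expansionEw (F : comm_series) c (S : {fset intpart}) :
    psum_expansion F c -> (finsupp c `<=` S)%fset ->
  forall N, F N = \sum_(lam <- S) c lam *: psum_part lam N.
Proof.
move=> cF sS N; rewrite cF; apply: big_fset_incl => // lam _.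
by move/fsfun_dflt ->; rewrite scale0r.
Qed.

Lemma psum_expansion_unique (F : comm_series) c c' :
  psum_expansion F c -> psum_expansion F c' -> c = c'.
Proof.
move=> cF cF'; pose S := (finsupp c `|` finsupp c')%fset.
apply/fsfunP => lam; have [lamS|] := boolP (lam \in S); last first.
  by rewrite inE negb_or => /andP[/fsfun_dflt -> /fsfun_dflt ->].
apply: (@psum_part_free S) lamS; first exact: fset_uniq.
move=> N; have E := psum_expansionEw cF (fsubsetUl _ (finsupp c')) N.
exact: etrans (esym E) (psum_expansionEw cF' (fsubsetUr (finsupp c) _) N).
Qed.

End PowerSums.

(** * The chromatic symmetric function *)

Section ChromaticSymmetric.
Variables (d : Order.disp_t) (V : finOrderType d).
Implicit Types (G R : {set {set V}}).

Lemma comp_type_part R :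
  sorted geq (comp_type R) && all (fun m => 0 < m)%N (comp_type R).
Proof.
rewrite /comp_type sort_sorted => [|a b]; last exact: leq_total.
rewrite all_sort; apply/allP => _ /mapP[B BR ->]; rewrite card_gt0.
have /and3P[_ _ n0] := comp_partitionP R.
by apply: contraNneq n0 => <-; rewrite -mem_enum.
Qed.

Definition comp_intpart R : intpart := Sub (comp_type R) (comp_type_part R).

Lemma chrom_sym_forests G N : is_graph G ->
  chrom_sym G N
    = \sum_(R : {set {set V}} | inc_conn_forest G R)
        (-1) ^+ #|R| *: psum_part (comp_intpart R) N.
Proof.
move=> gG; apply: etrans (sum_proper_colorings _ gG) _.
apply: eq_bigr => R _; apply: congr1.
pose x (j : 'I_N) : {malg rat[{cmonom 'I_N}]} := << ucm j >>.
apply: etrans (sum_constant_on_blocks x (comp_partitionP R)) _.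
rewrite /psum_part /= /comp_type.
rewrite (perm_big [seq #|B : {set V}| | B <- enum (comp_partition R)]) /=.
  by rewrite big_map big_enum.
by rewrite perm_sort.
Qed.

Definition sym_coef G : {fsfun intpart -> rat with 0} :=
  [fsfun lam in [fset comp_intpart R | R in {set {set V}}]%fset =>
     (-1) ^+ (#|V| - size (val lam))
      * #|[set R | inc_conn_forest G R & comp_type R == val lam]|%:R].

(** A partition outside the finite support in the definition of [sym_coef] is the
    type of no graph, and the number of forests is 0 as well. *)
Lemma sym_coefE G (lam : intpart) :
  sym_coef G lam = (-1) ^+ (#|V| - size (val lam))
      * #|[set R | inc_conn_forest G R & comp_type R == val lam]|%:R.
Proof.
rewrite fsfunE; case: ifPn => // lamS.
rewrite eq_card0 ?mulr0 // => R; rewrite inE; apply/negP => /andP[_ /eqP E].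
by case/negP: lamS; apply/imfsetP; exists R => //; apply: val_inj.
Qed.

Lemma size_comp_type R : size (comp_type R) = #|comp_partition R|.
Proof. by rewrite size_sort size_map -cardE. Qed.

Lemma sym_coef_expansion G : is_graph G -> psum_expansion (chrom_sym G) (sym_coef G).
Proof.
move=> gG N; pose S := [fset comp_intpart R | R in {set {set V}}]%fset.
have sS : (finsupp (sym_coef G) `<=` S)%fset.
  apply/fsubsetP => lam; apply: contraLR => lamS.
  by rewrite mem_finsupp negbK fsfunE (negbTE lamS).
transitivity (\sum_(lam <- S) sym_coef G lam *: psum_part lam N); last first.
  apply/esym/big_fset_incl => // lam _ /fsfun_dflt ->; exact: scale0r.
rewrite chrom_sym_forests //.
under [RHS]eq_bigr => lam _.
  rewrite sym_coefE -signed_forest_count => [|R _ /eqP E].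
    rewrite scaler_suml; over.
  by rewrite -size_comp_type E.
rewrite (exchange_big_dep (inc_conn_forest G)) /= => [|lam R _ /andP[] //].
apply: eq_bigr => R fR.
have RS : comp_intpart R \in S by apply/imfsetP; exists R.
rewrite (eq_bigl (pred1 (comp_intpart R))) => [|lam]; last first.
  by rewrite fR /= [RHS]eq_sym; exact: (val_eqE (comp_intpart R) lam).
by rewrite -big_filter filter_pred1_uniq ?fset_uniq // big_seq1.
Qed.

End ChromaticSymmetric.

(** * Coefficients count increasing connected forests *)

Theorem corollary1 (d : Order.disp_t) (V : finOrderType d) (n : nat)
    (G : {set {set V}}) (card_V : #|V| = n) (G_graph : is_graph G) :
  [/\ (exists! chi : {poly rat}, chromatic_polynomial G chi)
      /\ forall chi : {poly rat}, chromatic_polynomial G chi ->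
         (-1) ^+ (n - 1) * chi`_1
           = #|[set rT : V * {set {set V}}
                 | inc_conn_tree G [set: V] rT.1 rT.2]|%:R
         /\ forall q : nat,
            [/\ (-1) ^+ (n - q) * chi`_q
                  = #|[set R : {set {set V}}
                        | inc_conn_forest G R & #|comp_partition R| == q]|%:R
              & forall R : {set {set V}}, inc_conn_forest G R ->
                (#|comp_partition R| = q <-> (#|R| + q)%N = n)],
      (exists! c : {fsfun intpart -> rat with 0}, psum_expansion (chrom_sym G) c)
      /\ forall c : {fsfun intpart -> rat with 0}, psum_expansion (chrom_sym G) c ->
         forall lam : intpart, sumn (val lam) = n ->
         (-1) ^+ (n - size (val lam)) * c lam
           = #|[set R : {set {set V}}
                 | inc_conn_forest G R & comp_type R == val lam]|%:R
    & (exists! c : {ffun setpart V -> rat}, psum_setpart_expansion (chrom_nsym G) c)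
      /\ forall c : {ffun setpart V -> rat}, psum_setpart_expansion (chrom_nsym G) c ->
         forall P : setpart V,
         (-1) ^+ (n - #|val P|) * c P
           = #|[set R : {set {set V}}
                 | inc_conn_forest G R & comp_partition R == val P]|%:R].
Proof.
split.
- split.
    exists (forest_poly G); split=> [|chi]; first exact: forest_poly_chromatic.
    exact/chromatic_polynomial_unique/forest_poly_chromatic.
  move=> chi /(chromatic_polynomial_unique (forest_poly_chromatic G_graph)) <-.
  have coefE q : (-1) ^+ (n - q) * (forest_poly G)`_q
      = #|[set R | inc_conn_forest G R & #|comp_partition R| == q]|%:R.
    by rewrite coef_forest_poly card_V signrMK.
  split=> [|q]; first by rewrite coefE card_inc_conn_trees.
  split=> // R /inc_conn_forest_card; rewrite card_V => cR.
  by split=> [<- //|]; rewrite -cR => /addnI.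
- split.
    exists (sym_coef G); split=> [|c]; first exact: sym_coef_expansion.
    exact/psum_expansion_unique/sym_coef_expansion.
  move=> c /(psum_expansion_unique (sym_coef_expansion G_graph)) <- lam _.
  by rewrite sym_coefE card_V signrMK.
split.
  exists (nsym_coef G); split=> [|c]; first exact: nsym_coef_expansion.
  exact/psum_setpart_expansion_unique/nsym_coef_expansion.
move=> c /(psum_setpart_expansion_unique (nsym_coef_expansion G_graph)) <- P.
by rewrite ffunE card_V signrMK.
Qed.
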